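(* Let $n\ge 2$. For parameters $a=(a_1,\dots,a_n)\in(0,\infty)^n$ and $b=(b_1,\dots,b_n)\in(0,\infty)^n$, let $W=(w_{ij})$ be a random $n\times n$ matrix with $w_{ii}=0$ for all $i$ and independent off-diagonal entries, where $w_{ij}$ $(i\ne j)$ has the beta distribution with parameters $a_i$ and $b_j$. Let $R_i=\sum_{j\ne i}\ln w_{ij}$ $(i=1,\dots,n)$ be the row-sums of the matrix with off-diagonal entries $\ln w_{ij}$ and let $C_j=\sum_{i\ne j}\ln(1-w_{ij})$ $(j=1,\dots,n)$ be the column-sums of the matrix with off-diagonal entries $\ln(1-w_{ij})$ (the diagonals of both matrices being ignored). Then $(R_1,\dots,R_n,C_1,\dots,C_n)$ is a sufficient statistic for the parameter $(a,b)$ in this family of distributions.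
   Context: The beta distribution with parameters $\alpha,\beta>0$ has density $\frac{\Gamma(\alpha+\beta)}{\Gamma(\alpha)\Gamma(\beta)}w^{\alpha-1}(1-w)^{\beta-1}$ on $(0,1)$. Sufficiency is in the usual statistical sense, for the family of laws of $W$ indexed by $(a,b)\in(0,\infty)^{2n}$. *)

(* Defs.v *)
From HB Require Import structures.
From mathcomp Require Import all_boot all_order all_algebra.
From mathcomp Require Import all_classical all_reals all_analysis.

Set Implicit Arguments.
Unset Strict Implicit.
Unset Printing Implicit Defensive.

Import Order.TTheory GRing.Theory Num.Theory.
Import numFieldNormedType.Exports.

Local Open Scope classical_set_scope.
Local Open Scope ring_scope.

Section beta_distribution_real_parameters.
Context {R : realType}.
Implicit Types x al be w : R.

Definition Gamma x : R :=
  \int[@lebesgue_measure R]_(t in `]0, +oo[) (t `^ (x - 1) * expR (- t)).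

(* The library's beta_pdf only takes natural numbers as parameters. *)
Definition betaR_density al be w : R :=
  Gamma (al + be) / (Gamma al * Gamma be)
  * w `^ (al - 1) * (1 - w) `^ (be - 1).

Definition beta_distributed d (T : measurableType d) (P : probability T R)
    (X : T -> R) al be : Prop :=
  forall A : set R, measurable A ->
    P (X @^-1` A) =
    (\int[@lebesgue_measure R]_(w in A `&` `]0%R, 1%R[)
        (betaR_density al be w)%:E)%E.

End beta_distribution_real_parameters.

Definition mutually_independent (R : realType) d (T : measurableType d)
    (P : probability T R) (I : finType) (D : {set I}) (X : I -> T -> R) : Prop :=
  forall (J : {set I}) (A : I -> set R), J \subset D ->
    (forall i, i \in J -> measurable (A i)) ->
    P (\bigcap_(i in [set` J]) (X i @^-1` A i)) =
    (\prod_(i in J) P (X i @^-1` A i))%E.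

(* The sigma-algebra generated by the entries, i.e. the Borel sets of
   R^(n * n). *)
Definition mx_cylinders (R : realType) (n : nat) : set (set 'M[R]_n) :=
  [set A | exists i j, exists2 B : set R,
             measurable B & A = [set M : 'M[R]_n | B (M i j)]].

Definition mxspace (R : realType) (n : nat) :=
  g_sigma_algebraType (@mx_cylinders R n).

HB.instance Definition _ (R : realType) (n : nat) :=
  Measurable.on (mxspace R n).

(* g \o T is a version of the conditional probability of A given T under P. *)
Definition cond_prob_version (R : realType) d d' (X : measurableType d)
    (Y : measurableType d') (P : probability X R) (T : X -> Y) (A : set X)
    (g : Y -> R) : Prop :=
  [/\ measurable_fun [set: Y] g,
      forall y, 0 <= g y <= 1
    & forall B : set Y, measurable B ->
        P (A `&` T @^-1` B) = (\int[P]_(x in T @^-1` B) (g (T x))%:E)%E].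

(* Sufficiency in the sense of Halmos and Savage: the conditional probability
   of every event given T has a version that does not depend on theta. *)
Definition sufficient (R : realType) d d' (X : measurableType d)
    (Y : measurableType d') (Theta : Type) (Q : Theta -> probability X R)
    (T : X -> Y) : Prop :=
  measurable_fun [set: X] T /\
  forall A : set X, measurable A ->
    exists g : Y -> R, forall theta, cond_prob_version (Q theta) T A g.

Record beta_param (R : realType) (n : nat) := BetaParam {
  param_a : 'I_n -> R;
  param_b : 'I_n -> R;
  param_a_gt0 : forall i, 0 < param_a i;
  param_b_gt0 : forall j, 0 < param_b j }.

Definition beta_random_matrix (R : realType) (n : nat) d (T : measurableType d)
    (P : probability T R) (W : T -> 'M[R]_n) (a b : 'I_n -> R) : Prop :=
  [/\ forall t i, W t i i = 0,
      mutually_independent P [set ij : 'I_n * 'I_n | ij.1 != ij.2]%SET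
        (fun ij t => W t ij.1 ij.2)
    & forall i j, i != j -> beta_distributed P (fun t => W t i j) (a i) (b j)].

Definition ln_row_sum (R : realType) (n : nat) (M : 'M[R]_n) (i : 'I_n) : R :=
  \sum_(j < n | j != i) ln (M i j).

Definition ln_col_sum (R : realType) (n : nat) (M : 'M[R]_n) (j : 'I_n) : R :=
  \sum_(i < n | i != j) ln (1 - M i j).

Definition row_col_stat (R : realType) (n : nat) (M : mxspace R n) :
    (n.-tuple R * n.-tuple R)%type :=
  ([tuple ln_row_sum M i | i < n], [tuple ln_col_sum M j | j < n]).

(* Main.v *)
Require Import Defs.
From HB Require Import structures.
From mathcomp Require Import all_boot all_order all_algebra.
From mathcomp Require Import all_classical all_reals all_analysis.
From mathcomp Require Import measurable_realfun.

Set Implicit Arguments.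
Unset Strict Implicit.
Unset Printing Implicit Defensive.

Import Order.TTheory GRing.Theory Num.Theory.
Import numFieldNormedType.Exports.

Local Open Scope classical_set_scope.
Local Open Scope ring_scope.

(** The proof is the factorization argument.  The parameter with all [a_i] and
[b_j] equal to 1 makes the off-diagonal entries uniform on [(0,1)], and the
beta law with parameters [(a_i, b_j)] has with respect to the uniform one the
density [c_ij * exp ((a_i - 1) ln w + (b_j - 1) ln (1 - w))].  Multiplied over
all [i != j], these densities give
[(\prod c_ij) * exp (\sum_i (a_i - 1) R_i + \sum_j (b_j - 1) C_j)],
a function [h] of the parameter and of the statistic [T] alone (matrix_likE).
Hence every law of the family is [(h \o T) . Q0], where [Q0] is the law at the
reference parameter (beta_matrix_law_lik), and a version of the conditional
probability given [T] under [Q0] serves for all parameters at once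
(factorization_sufficient).

Nearly every integral identity used is an instance of ge0_integral_transfer: if
[F1 . mu1] and [F2 . mu2] have the same image in a space [Y] under two maps
[T1] and [T2], then they integrate in the same way the functions that factor
through these maps.  It gives the change of density for one entry, the product
formula for independent factors (one factor at a time), and both exchanges of
integrals in factorization_sufficient.

No value of the Gamma function is computed: the constants [c_ij] stay inside
[h], where only their sign matters, and the constant of the reference law is 1
because that law has total mass 1. *)

(** * Weighted measures and change of variables *)

Lemma measurable_preimage d d' (X : measurableType d) (Y : measurableType d')
    (f : X -> Y) (B : set Y) :
  measurable_fun [set: X] f -> measurable B -> measurable (f @^-1` B).
Proof. by move=> mf mB; rewrite -[_ @^-1` _]setTI; exact: mf. Qed.

Section weighted_measure.
Local Open Scope ereal_scope.
Context d (T : measurableType d) (R : realType).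
Variables (mu : {measure set T -> \bar R}) (F : T -> R).

(** The measure [F . mu]; the proofs about [F] are arguments so that the measure
structure below can be inferred from the term. *)
Definition weighted_measure (mF : measurable_fun [set: T] F)
    (F0 : forall x, (0 <= F x)%R) : set T -> \bar R :=
  fun A => \int[mu]_(x in A) (F x)%:E.

Hypotheses (mF : measurable_fun [set: T] F) (F0 : forall x, (0 <= F x)%R).
Local Notation nu := (weighted_measure mF F0).

Let nu0 : nu set0 = 0. Proof. exact: integral_set0. Qed.

Let nu_ge0 A : 0 <= nu A.
Proof. by apply: integral_ge0 => x _; rewrite lee_fin. Qed.

Let nu_sigma_additive : semi_sigma_additive nu.
Proof.
apply: semi_sigma_additive_nng_induced; first exact/measurable_EFinP.
by move=> x; rewrite lee_fin.
Qed.

HB.instance Definition _ :=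
  isMeasure.Build _ _ _ nu nu0 nu_ge0 nu_sigma_additive.

Import HBNNSimple.

(** By monotone convergence both sides are limits of the integrals of an
increasing sequence of simple functions, and on indicators the identity is the
definition of the weighted measure. *)
Lemma ge0_integral_weighted (D : set T) (f : T -> \bar R) :
  measurable D -> measurable_fun D f -> (forall x, D x -> 0 <= f x) ->
  \int[nu]_(x in D) f x = \int[mu]_(x in D) ((F x)%:E * f x).
Proof.
move=> mD mf f0; pose h := nnsfun_approx mD mf.
have mFE E : measurable_fun E (EFin \o F).
  by apply/measurable_EFinP; exact: measurable_funTS.
have mhn n E : measurable_fun E (EFin \o h n).
  by apply/measurable_EFinP; exact: measurable_funTS.
have nd_h x : D x -> {homo (fun n => (h n x)%:E) : m n / (m <= n)%N >-> m <= n}.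
  by move=> _ m n mn; rewrite lee_fin; exact/lefP/nd_nnsfun_approx.
have -> : \int[nu]_(x in D) f x =
    limn (fun n => \int[nu]_(x in D) (EFin \o h n) x).
  rewrite -monotone_convergence//.
    apply: eq_integral => x /[!inE] Dx; apply/esym/cvg_lim => //.
    exact: cvg_nnsfun_approx.
  by move=> n x _ /=; rewrite lee_fin.
have -> : \int[mu]_(x in D) ((F x)%:E * f x) =
    limn (fun n => \int[mu]_(x in D) ((F x)%:E * (h n x)%:E)).
  rewrite -monotone_convergence//.
  - apply: eq_integral => x /[!inE] Dx; apply/esym/cvg_lim => //.
    by apply: cvgeZl => //; exact: cvg_nnsfun_approx.
  - by move=> n; apply: emeasurable_funM; [exact: mFE|exact: mhn].
  - by move=> n x _; rewrite mule_ge0// lee_fin.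
  - by move=> x Dx m n mn; rewrite lee_wpmul2l ?lee_fin//; exact: nd_h.
congr (limn _); apply/funext => n.
have hE x : (h n x)%:E =
    \sum_(r \in range (h n)) (r%:E * (\1_(h n @^-1` [set r]) x)%:E).
  by rewrite [in LHS]fimfunE -fsumEFin.
have mind r E :
    measurable_fun E (fun x => (\1_(h n @^-1` [set r]) x)%:E : \bar R).
  by apply/measurable_EFinP/measurable_funTS; exact: measurable_indic.
have rge0 r x : 0 <= r%:E * (\1_(h n @^-1` [set r]) x)%:E.
  by rewrite -EFinM; exact: nnfun_muleindic_ge0.
rewrite [LHS](eq_integral (fun x => \sum_(r \in range (h n))
  (r%:E * (\1_(h n @^-1` [set r]) x)%:E))) ; last by move=> x _; exact: hE.
rewrite [RHS](eq_integral (fun x => \sum_(r \in range (h n))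
  ((F x)%:E * (r%:E * (\1_(h n @^-1` [set r]) x)%:E)))); last first.
  by move=> x _; rewrite hE ge0_mule_fsumr.
rewrite !ge0_integral_fsum//.
- apply: eq_fsbigr => r /[!inE] -[t _ <-].
  have h0 : 0 <= (h n t)%:E by rewrite lee_fin.
  rewrite ge0_integralZl// integral_indic//.
  under [RHS]eq_integral do rewrite muleCA.
  rewrite ge0_integralZl//; last 2 first.
  - exact: emeasurable_funM.
  - by move=> x _; rewrite mule_ge0// lee_fin.
  congr (_ * _); rewrite setIC [LHS]integral_mkcondr.
  by apply: eq_integral => x _; rewrite epatch_indic.
- move=> r; apply: emeasurable_funM; first exact: mFE.
  exact: emeasurable_funM.
- by move=> r x _; rewrite mule_ge0// lee_fin.
- by move=> r; exact: emeasurable_funM.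
Qed.

End weighted_measure.

(** The hypothesis says that the images of [F1 . mu1] and [F2 . mu2] under [T1]
and [T2] are the same measure on [Y], and both integrals are the integral of
[f] against that measure. *)
Lemma ge0_integral_transfer (R : realType) d1 d2 d (X1 : measurableType d1)
    (X2 : measurableType d2) (Y : measurableType d)
    (mu1 : {measure set X1 -> \bar R}) (mu2 : {measure set X2 -> \bar R})
    (T1 : X1 -> Y) (T2 : X2 -> Y) (F1 : X1 -> R) (F2 : X2 -> R) :
  measurable_fun [set: X1] T1 -> measurable_fun [set: X2] T2 ->
  measurable_fun [set: X1] F1 -> measurable_fun [set: X2] F2 ->
  (forall x, 0 <= F1 x) -> (forall x, 0 <= F2 x) ->
  (forall B, measurable B -> \int[mu1]_(x in T1 @^-1` B) (F1 x)%:E =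
                             \int[mu2]_(x in T2 @^-1` B) (F2 x)%:E)%E ->
  forall (D : set Y) (f : Y -> \bar R), measurable D ->
    measurable_fun [set: Y] f -> (forall y, 0 <= f y)%E ->
  (\int[mu1]_(x in T1 @^-1` D) ((F1 x)%:E * f (T1 x)) =
   \int[mu2]_(x in T2 @^-1` D) ((F2 x)%:E * f (T2 x)))%E.
Proof.
move=> mT1 mT2 mF1 mF2 F10 F20 F12 D f mD mf f0.
have m1D := measurable_preimage mT1 mD; have m2D := measurable_preimage mT2 mD.
have mfS d0 (X : measurableType d0) (S : X -> Y) E :
    measurable_fun setT S -> measurable_fun E (f \o S).
  by move=> mS; apply: measurable_funTS; exact: measurableT_comp.
rewrite -(ge0_integral_weighted mu1 mF1 F10 m1D (mfS _ _ _ _ mT1)); last first.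
  by move=> x _; exact: f0.
rewrite -(ge0_integral_weighted mu2 mF2 F20 m2D (mfS _ _ _ _ mT2)); last first.
  by move=> x _; exact: f0.
rewrite -(ge0_integral_pushforward mT1)//; last exact: measurable_funTS.
rewrite -(ge0_integral_pushforward mT2)//; last exact: measurable_funTS.
by apply: eq_measure_integral => B mB _; exact: F12.
Qed.

(** * Conditional probabilities and the factorization criterion *)

Section conditional_probability.
Local Open Scope ereal_scope.

(** The Radon-Nikodym density [f] of a measure dominated setwise is at most 1
almost everywhere: on [N = {f > 1}] the positive function [f - 1] has integral
[nu N - mu N <= 0].  Truncating [f] at 1 therefore keeps the integrals. *)
Lemma radon_nikodym_le1 (R : realType) d (Y : measurableType d)
    (mu nu : {finite_measure set Y -> \bar R}) :
  (forall B, measurable B -> nu B <= mu B) ->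
  exists g : Y -> R, [/\ measurable_fun [set: Y] g,
    forall y, (0 <= g y <= 1)%R
    & forall B, measurable B -> nu B = \int[mu]_(y in B) (g y)%:E].
Proof.
move=> numu.
have /radon_nikodym_finite [f [f0 intf nuE]] : nu `<< mu.
  apply/null_content_dominatesP => B mB muB0.
  by apply/eqP; rewrite -measure_le0 -muB0; exact: numu.
have mf : measurable_fun setT f by exact: measurable_int intf.
pose N := [set y | 1 < f y].
have mN : measurable N.
  by rewrite -[N]setTI; exact: emeasurable_fun_o_infty.
pose h y := mine (f y) 1.
have mh : measurable_fun setT h by exact: measurable_mine.
have h0 y : 0 <= h y by rewrite le_min f0 lee01.
have hE y : (fine (h y))%:E = h y.
  rewrite fineK// ge0_fin_numE// (@le_lt_trans _ _ 1) ?ltry//.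
  by rewrite ge_min lexx orbT.
have fB1 y : N y -> 0 <= f y - 1 by move=> /ltW; rewrite sube_ge0.
have mfB1 : measurable_fun N (fun y => f y - 1).
  by apply: emeasurable_funB => //; exact: measurable_funTS.
have int0 : \int[mu]_(y in N) (f y - 1) = 0.
  apply/eqP; rewrite eq_le integral_ge0// andbT.
  have : \int[mu]_(y in N) f y <= mu N by rewrite -nuE// numu.
  rewrite (eq_integral (fun y => (f y - 1) + 1)); last first.
    by move=> y _; rewrite subeK.
  rewrite ge0_integralD// integral_cst// mul1e.
  rewrite -[leRHS]add0e leeD2rE//.
  exact: fin_num_measure.
have f_le1 : ae_eq mu setT f h.
  have : ae_eq mu N (fun y => f y - 1) (cst 0).
    apply/ae_eq_integral_abs => //; rewrite -int0; apply: eq_integral => y.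
    by rewrite inE => Ny; rewrite gee0_abs// fB1.
  apply: filterS => y /= fy _; rewrite /h.
  case: (leP (f y) 1) => // fy1.
  by rewrite -[LHS](@subeK _ _ 1)// (fy fy1) add0e.
exists (fine \o h); split.
- exact: measurableT_comp.
- by move=> y /=; rewrite -!lee_fin hE h0 /= ge_min lexx orbT.
- move=> B mB; rewrite nuE//.
  under [RHS]eq_integral do rewrite hE.
  apply: ge0_ae_eq_integral => //; try exact: measurable_funTS.
  exact: ae_eq_subset f_le1.
Qed.

(** The image of a finite measure; the map is bundled with its measurability so
that the finite measure structure can be inferred from the term. *)
Definition image_measure d d' (X : measurableType d) (Y : measurableType d')
    (R : realType) (mu : {finite_measure set X -> \bar R})
    (T : {mfun X >-> Y}) : set Y -> \bar R :=
  pushforward mu T.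

Section image_measure.
Context d d' (X : measurableType d) (Y : measurableType d') (R : realType).
Variables (mu : {finite_measure set X -> \bar R}) (T : {mfun X >-> Y}).

Let image0 : image_measure mu T set0 = 0. Proof. exact: measure0. Qed.

Let image_ge0 B : 0 <= image_measure mu T B.
Proof. exact: measure_ge0. Qed.

Let image_sigma_additive : semi_sigma_additive (image_measure mu T).
Proof. exact: measure_semi_sigma_additive. Qed.

HB.instance Definition _ := isMeasure.Build _ _ _ (image_measure mu T)
  image0 image_ge0 image_sigma_additive.

Let image_fin_num_fun : fin_num_fun (image_measure mu T).
Proof.
move=> B mB; apply: fin_num_measure; exact: measurable_preimage.
Qed.

HB.instance Definition _ := Measure_isFinite.Build _ _ _ (image_measure mu T)
  image_fin_num_fun.

End image_measure.

(** The conditional probability is the density of [B |-> P (A `&` T @^-1` B)]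
with respect to the law of [T], which dominates it setwise. *)
Lemma conditional_probability (R : realType) d d' (X : measurableType d)
    (Y : measurableType d') (P : probability X R) (T : X -> Y) (A : set X) :
  measurable_fun [set: X] T -> measurable A ->
  exists g : Y -> R, cond_prob_version P T A g.
Proof.
move=> mT mA.
have mpre B : measurable B -> measurable (T @^-1` B).
  exact: measurable_preimage.
pose mTp : {mfun X >-> Y} := HB.pack T (isMeasurableFun.Build _ _ _ _ T mT).
have PAoo : P A < +oo by rewrite -ge0_fin_numE// fin_num_measure.
pose mu : {finite_measure set Y -> \bar R} := image_measure P mTp.
pose nu : {finite_measure set Y -> \bar R} :=
  image_measure (mfrestr mA PAoo) mTp.
have numu B : measurable B -> nu B <= mu B.
  move=> mB; apply: le_measure; rewrite ?inE//; last exact: mpre.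
  by apply: measurableI => //; exact: mpre.
have [g [mg g01 nuE]] := radon_nikodym_le1 numu.
exists g; split => // B mB.
rewrite setIC; have := nuE _ mB.
rewrite ge0_integral_pushforward//.
- by apply/measurable_EFinP; exact: measurable_funTS.
- by move=> y _; rewrite lee_fin; case/andP: (g01 y).
Qed.

(** The version [g] under the reference law works for every [theta]: the
identity that defines [g], integrated against the weight [h theta \o T], turns
[\1_A] into [g \o T], and this same weight turns the reference law into
[Q theta]. *)
Lemma factorization_sufficient (R : realType) d d' (X : measurableType d)
    (Y : measurableType d') (Theta : Type) (Q : Theta -> probability X R)
    (T : X -> Y) (theta0 : Theta) (h : Theta -> Y -> R) :
  measurable_fun [set: X] T ->
  (forall theta, measurable_fun [set: Y] (h theta)) ->
  (forall theta y, 0 <= h theta y)%R ->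
  (forall theta A, measurable A ->
     Q theta A = \int[Q theta0]_(x in A) (h theta (T x))%:E) ->
  sufficient Q T.
Proof.
move=> mT mh h0 QE; split => // A mA.
have mpre B : measurable B -> measurable (T @^-1` B).
  exact: measurable_preimage.
have [g [mg g01 gE]] := conditional_probability (Q theta0) mT mA.
have g0 y : (0 <= g y)%R by case/andP: (g01 y).
exists g => theta; split => // B mB.
have mind : measurable_fun [set: X] (\1_A : X -> R) by exact: measurable_indic.
have m1 : measurable_fun [set: X] (cst 1%R : X -> R) by exact: measurable_cst.
have mgT : measurable_fun [set: X] (g \o T) by exact: measurableT_comp.
have mhT : measurable_fun [set: X] (h theta \o T) by exact: measurableT_comp.
(* under the reference law, 1_A and g \o T have the same image under T *)
have condA := ge0_integral_transfer (mu1 := Q theta0) (mu2 := Q theta0)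
  mT mT mind mgT _ _ _ mB _ _.
(* the law of T under Q theta is h theta times its law under Q theta0 *)
have condQ := ge0_integral_transfer (mu1 := Q theta) (mu2 := Q theta0)
  mT mT m1 mhT _ _ _ mB _ _.
transitivity (\int[Q theta0]_(x in T @^-1` B)
    ((\1_A x)%:E * (h theta (T x))%:E)).
  rewrite QE; last by apply: measurableI => //; exact: mpre.
  rewrite setIC integral_mkcondr; apply: eq_integral => x _.
  by rewrite epatch_indic muleC.
rewrite (condA _ _ _ (EFin \o h theta)).
- under eq_integral do rewrite muleC.
  rewrite -(condQ _ _ _ (EFin \o g)).
  + by apply: eq_integral => x _; rewrite mul1e.
  + by [].
  + by move=> x; exact: h0.
  + move=> C mC; rewrite -QE; last exact: mpre.
    by rewrite [LHS](integral_cst _ (mpre C mC) 1) mul1e.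
  + exact/measurable_EFinP.
  + by move=> y; rewrite lee_fin.
- by [].
- by move=> x; exact: g0.
- move=> C mC; rewrite -gE// integral_indic//; exact: mpre.
- exact/measurable_EFinP.
- by move=> y; rewrite lee_fin.
Qed.

End conditional_probability.

(** * Expectation of a product of independent factors *)

Lemma integral_indic_preimage (R : realType) d d' (T : measurableType d)
    (Y : measurableType d') (mu : {measure set T -> \bar R}) (X : T -> Y)
    (A : set Y) : measurable_fun [set: T] X -> measurable A ->
  (\int[mu]_t (\1_A (X t))%:E = mu (X @^-1` A))%E.
Proof.
move=> mX mA; rewrite -[in RHS](setIT (X @^-1` A)) -integral_indic//.
exact: measurable_preimage.
Qed.

(** Independence is the case where every [f i] is an indicator.  The indicators
are then replaced by general functions one at a time: when the formula is known
for all indicators at index [k], it says that, with [F] the product of the other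
factors and [C] its expectation, [F . P] and [C . P] have the same image under
[X k], so that they also agree on [f k (X k)].  The means [m i] are real
numbers, which keeps products in [\bar R] out of the induction. *)
Lemma expectation_prod_indep (R : realType) d (T : measurableType d)
    (P : probability T R) (I : finType) (D : {set I}) (X : I -> T -> R) :
  (forall i, i \in D -> measurable_fun [set: T] (X i)) ->
  mutually_independent P D X ->
  forall (f : I -> R -> R) (m : I -> R),
    (forall i, measurable_fun [set: R] (f i)) -> (forall i x, 0 <= f i x) ->
    (forall i, i \in D -> \int[P]_t (f i (X i t))%:E = (m i)%:E)%E ->
  (\int[P]_t (\prod_(i in D) f i (X i t))%:E = (\prod_(i in D) m i)%:E)%E.
Proof.
move=> mX indX f m mf f0 fm.
have mpre i B : i \in D -> measurable B -> measurable (X i @^-1` B).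
  by move=> iD; apply: measurable_preimage; exact: mX.
(* s lists the indices at which the function may be arbitrary *)
pose indicator_off (s : seq I) (g : I -> R -> R) := forall i, i \in D ->
  i \notin s -> exists2 A, measurable A & g i = \1_A.
suff : forall (s : seq I) (g : I -> R -> R) (c : I -> R), indicator_off s g ->
    (forall i, measurable_fun [set: R] (g i)) -> (forall i x, 0 <= g i x) ->
    (forall i, i \in D -> \int[P]_t (g i (X i t))%:E = (c i)%:E)%E ->
    (\int[P]_t (\prod_(i in D) g i (X i t))%:E = (\prod_(i in D) c i)%:E)%E.
  by move/(_ (enum I) f m); apply => // i _; rewrite mem_enum.
elim=> [|k s IHs] g c gs mg g0 gc.
  have /choice [A gA] : forall i, exists A, i \in D ->
      measurable A /\ g i = \1_A.
    move=> i; have [iD|] := boolP (i \in D); last by exists set0.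
    by have [A mA giA] := gs i iD isT; exists A.
  have mA i : i \in D -> measurable (A i) by move=> /gA[].
  have cE i : i \in D -> (c i)%:E = P (X i @^-1` A i).
    move=> iD; rewrite -gc// (gA i iD).2 integral_indic_preimage//.
      exact: mX.
    exact: mA.
  transitivity (P (\bigcap_(i in [set` D]) (X i @^-1` A i))); last first.
    rewrite indX// -prodEFin; apply: eq_bigr => i iD; exact/esym/cE.
  have mcap : measurable (\bigcap_(i in [set` D]) (X i @^-1` A i)).
    by apply: fin_bigcap_measurable => // i iD; apply: mpre => //; exact: mA.
  rewrite -[X in P X]setIT -integral_indic//.
  apply: eq_integral => t _; congr EFin.
  rewrite indicE; have [|/negP tn] := boolP (t \in _).
    rewrite inE => tD; rewrite big1// => i iD.
    rewrite (gA i iD).2 indicE mem_set//; exact: tD.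
  have [i iD tAi] : exists2 i, i \in D & ~ A i (X i t).
    apply: contrapT => nex; apply: tn; rewrite inE => i /= iD.
    by apply: contrapT => tAi; apply: nex; exists i.
  by rewrite (bigD1 i)//= (gA i iD).2 indicE memNset// mul0r.
have [kD|kD] := boolP (k \in D); last first.
  apply: IHs => // i iD isn; apply: gs => //.
  by rewrite inE negb_or isn andbT; apply: contraNneq kD => <-.
pose F t := \prod_(i in D | i != k) g i (X i t).
pose C := \prod_(i in D | i != k) c i.
have c0 i : i \in D -> 0 <= c i.
  by move=> iD; rewrite -lee_fin -gc// integral_ge0// => t _; rewrite lee_fin.
have mgX i : i \in D -> measurable_fun [set: T] (fun t => g i (X i t)).
  by move=> iD; apply: measurableT_comp => //; exact: mX.
have mF : measurable_fun [set: T] F.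
  rewrite /F; under eq_fun do rewrite -big_filter.
  apply: measurable_prod => i; rewrite mem_filter => /andP[/andP[iD _] _].
  exact: mgX.
have F0 t : 0 <= F t by apply: prodr_ge0 => i _.
have C0 : 0 <= C by apply: prodr_ge0 => i /andP[iD _]; exact: c0.
have mC : measurable_fun [set: T] (cst C : T -> R) by exact: measurable_cst.
have FC B : measurable B ->
    (\int[P]_(t in X k @^-1` B) (F t)%:E = \int[P]_(t in X k @^-1` B) (C)%:E)%E.
  move=> mB; pose g' i := if i == k then \1_B else g i : R -> R.
  pose c' i := if i == k then fine (P (X k @^-1` B)) else c i.
  have PB : (fine (P (X k @^-1` B)))%:E = P (X k @^-1` B).
    by rewrite fineK// fin_num_measure//; exact: mpre.
  have := IHs g' c'; rewrite (bigD1 k)//= {2}/c' eqxx EFinM.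
  rewrite [X in (_ * X%:E)%E](_ : _ = C); last first.
    by apply: eq_bigr => i /andP[_ /negPf ik]; rewrite /c' ik.
  rewrite PB integral_cst; last exact: mpre.
  rewrite [in RHS]muleC => <-.
  - rewrite -[X k @^-1` B]setTI integral_mkcondr; apply: eq_integral => t _.
    rewrite epatch_indic [in RHS](bigD1 k)//= {1}/g' eqxx muleC -EFinM.
    congr (_ * _)%:E; apply: eq_bigr => i /andP[_ /negPf ik].
    by rewrite /g' ik.
  - move=> i iD isn; rewrite /g'; case: eqP => [_|/eqP ik]; first by exists B.
    by apply: gs => //; rewrite inE negb_or ik.
  - by move=> i; rewrite /g'; case: eqP => // _; exact: measurable_indic.
  - by move=> i x; rewrite /g'; case: eqP.
  - move=> i iD; rewrite /g' /c'; case: eqP => [->|_]; last exact: gc.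
    by rewrite PB integral_indic_preimage//; exact: mX.
have := @ge0_integral_transfer _ _ _ _ T T _ P P _ _ _ _ (mX k kD) (mX k kD)
  mF mC F0 (fun=> C0) FC setT (EFin \o g k) measurableT.
rewrite preimage_setT => transfer.
rewrite [in RHS](bigD1 k)//= EFinM -gc// muleC -ge0_integralZl//; last 2 first.
- by apply/measurable_EFinP; exact: mgX.
- by move=> t _; rewrite lee_fin.
rewrite -transfer.
- by apply: eq_integral => t _; rewrite (bigD1 k)//= mulrC EFinM.
- exact/measurable_EFinP.
- by move=> y; rewrite lee_fin.
Qed.

(** * The beta laws as an exponential family *)

Section beta_likelihood.
Context {R : realType}.
Implicit Types a b w : R.

Definition beta_const a b : R := Gamma (a + b) / (Gamma a * Gamma b).

(** The density of the beta law with respect to the uniform law, as an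
exponential family.  It is written without powers so that a product of such
densities is the exponential of a sum of logarithms on the whole line, and not
only where the entries lie in [(0,1)]. *)
Definition beta_lik a b w : R :=
  beta_const a b * expR ((a - 1) * ln w + (b - 1) * ln (1 - w)).

Lemma Gamma_ge0 a : 0 <= Gamma a.
Proof.
by apply: Rintegral_ge0 => t _; rewrite mulr_ge0 ?powR_ge0 ?expR_ge0.
Qed.

Lemma beta_const_ge0 a b : 0 <= beta_const a b.
Proof. by rewrite divr_ge0 ?mulr_ge0 ?Gamma_ge0. Qed.

Lemma beta_lik_ge0 a b w : 0 <= beta_lik a b w.
Proof. by rewrite mulr_ge0 ?beta_const_ge0 ?expR_ge0. Qed.

Lemma measurable_beta_lik a b : measurable_fun [set: R] (beta_lik a b).
Proof.
apply: measurable_funM => //; apply: measurableT_comp => //.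
apply: measurable_funD; apply: measurable_funM => //.
by apply: measurableT_comp => //; exact: measurable_funB.
Qed.

Lemma betaR_density_lik a b w : w \in `]0, 1[ ->
  betaR_density a b w = beta_lik a b w.
Proof.
rewrite in_itv/= => /andP[w0 w1].
rewrite /betaR_density /beta_lik -mulrA; congr (_ * _).
by rewrite /powR !gt_eqF ?subr_gt0// expRD.
Qed.

Lemma beta_lik11 w : beta_lik 1 1 w = beta_const 1 1.
Proof. by rewrite /beta_lik subrr !mul0r addr0 expR0 mulr1. Qed.

(** The law of [X0] is [(Gamma 2 / Gamma 1 ^ 2)] times the Lebesgue measure on
[(0,1)], and total mass 1 forces this constant to be 1. *)
Lemma beta_law_lik d0 (T0 : measurableType d0) (P0 : probability T0 R)
    (X0 : T0 -> R) d (T : measurableType d) (P : probability T R) (X : T -> R)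
    a b :
  measurable_fun [set: T0] X0 -> beta_distributed P0 X0 1 1 ->
  beta_distributed P X a b ->
  forall A, measurable A ->
    (P (X @^-1` A) = \int[P0]_(t in X0 @^-1` A) (beta_lik a b (X0 t))%:E)%E.
Proof.
move=> mX0 X0b Xb A mA; rewrite Xb//.
have mI : measurable (`]0, 1[%classic : set R) by exact: measurable_itv.
have bE a' b' (B : set R) : measurable B ->
    (\int[@lebesgue_measure R]_(w in B `&` `]0%R, 1%R[)
      (betaR_density a' b' w)%:E =
     \int[@lebesgue_measure R]_(w in B `&` `]0%R, 1%R[)
      (beta_lik a' b' w)%:E)%E.
  move=> mB; apply: eq_integral => w /[!inE] -[_ w01].
  by rewrite betaR_density_lik.
have mcst d1 (S : measurableType d1) (c : R) : measurable_fun [set: S] (cst c).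
  exact: measurable_cst.
have c11 (B : set R) : measurable B -> (P0 (X0 @^-1` B) =
    (beta_const 1 1)%:E * lebesgue_measure (B `&` `]0%R, 1%R[))%E.
  move=> mB; rewrite X0b// bE//.
  under eq_integral do rewrite beta_lik11.
  by rewrite integral_cst//; exact: measurableI.
have c1 : beta_const 1 1 = 1 :> R.
  have := c11 _ measurableT.
  rewrite setTI preimage_setT probability_setT lebesgue_measure_itv/=.
  by rewrite lte_fin ltr01 sube0 mule1 => -[].
have mind : measurable_fun [set: R] (\1_(`]0, 1[%classic) : R -> R).
  exact: measurable_indic.
rewrite bE//.
have transfer := @ge0_integral_transfer _ _ _ _ T0 _ _ P0 (@lebesgue_measure R)
  X0 idfun _ _ mX0 (@measurable_id _ _ _) (mcst _ _ 1) mind (fun=> ler01) _ _ A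
  (EFin \o beta_lik a b) mA _ _.
transitivity (\int[P0]_(t in X0 @^-1` A)
    ((cst 1 t)%:E * (beta_lik a b (X0 t))%:E))%E; last first.
  by apply: eq_integral => t _; rewrite mul1e.
rewrite [RHS]transfer.
- rewrite preimage_id integral_mkcondr; apply: eq_integral => w _.
  by rewrite epatch_indic muleC.
- by [].
- move=> B mB.
  have mXB := measurable_preimage mX0 mB.
  rewrite [LHS](integral_cst _ mXB 1) mul1e.
  apply: (etrans (c11 B mB)).
  by rewrite c1 mul1e preimage_id integral_indic// setIC.
- by apply/measurable_EFinP; exact: measurable_beta_lik.
- by move=> w; rewrite lee_fin beta_lik_ge0.
Qed.

End beta_likelihood.

(** * Random matrices with beta entries *)

Section matrix_space.
Context {R : realType} {n : nat}.

Definition mx_rect (A : 'I_n -> 'I_n -> set R) : set (mxspace R n) :=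
  [set M : 'M[R]_n | forall i j, A i j (M i j)].

Definition mx_rects : set (set (mxspace R n)) :=
  [set B | exists2 A : 'I_n -> 'I_n -> set R,
             (forall i j, measurable (A i j)) & B = mx_rect A].

Lemma measurable_entry (i j : 'I_n) :
  measurable_fun [set: mxspace R n] (fun M : mxspace R n => (M : 'M[R]_n) i j).
Proof.
by move=> _ B mB; rewrite setTI; apply: sub_sigma_algebra; exists i, j, B.
Qed.

Lemma measurable_mx_rect : mx_rects `<=` measurable.
Proof.
move=> _ [A mA ->].
have -> : mx_rect A = \bigcap_(ij in [set: 'I_n * 'I_n])
    ((fun M : mxspace R n => (M : 'M[R]_n) ij.1 ij.2) @^-1` A ij.1 ij.2).
  apply/seteqP; split => [M AM [i j] _|M AM i j]; first exact: AM.
  exact: (AM (i, j)).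
apply: fin_bigcap_measurable => // -[i j] _.
by apply: measurable_preimage => //; exact: measurable_entry.
Qed.

(** Rectangles are stable under intersection and contain the cylinders, so that
they generate the sigma-algebra. *)
Lemma mx_rect_measure_unique (m1 m2 : {measure set (mxspace R n) -> \bar R}) :
  (forall A, (forall i j, measurable (A i j)) ->
     m1 (mx_rect A) = m2 (mx_rect A)) ->
  (m1 setT < +oo)%E -> forall A, measurable A -> m1 A = m2 A.
Proof.
move=> m12 m1oo A mA.
have rectT : mx_rect (fun _ _ => setT) = setT.
  by apply/seteqP; split.
apply: (@g_sigma_algebra_measure_unique _ _ _ mx_rects measurable_mx_rect
  (fun=> setT)) => //.
- by move=> _; exists (fun _ _ => setT); rewrite ?rectT.
- by rewrite bigcup_const//; exists 0.
- move=> _ _ [B mB ->] [C mC ->]; exists (fun i j => B i j `&` C i j).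
    by move=> i j; exact: measurableI.
  apply/seteqP; split => [M [BM CM] i j|M BCM]; last first.
    by split=> i j; case: (BCM i j).
  by split; [exact: BM|exact: CM].
- by move=> _ [B mB ->]; exact: m12.
- apply: (smallest_sub _ _ mA); first exact: smallest_sigma_algebra.
  move=> _ [i [j [B mB ->]]]; apply: sub_sigma_algebra.
  exists (fun i' j' => if (i' == i) && (j' == j) then B else setT).
    by move=> i' j'; case: ifP.
  apply/seteqP; split => [M BM i' j'|M /(_ i j)]; last by rewrite !eqxx.
  by case: ifP => // /andP[/eqP -> /eqP ->].
Qed.

Lemma measurable_row_col_stat :
  measurable_fun [set: mxspace R n] (@row_col_stat R n).
Proof.
apply: measurable_fun_pair; apply/measurable_fun_tnthP => i.
- rewrite (_ : _ \o _ = fun M => ln_row_sum M i); last first.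
    by apply/funext => M /=; rewrite tnth_mktuple.
  rewrite /ln_row_sum; under eq_fun do rewrite -big_filter.
  apply: measurable_sum => j; apply: measurableT_comp => //.
  exact: measurable_entry.
- rewrite (_ : _ \o _ = fun M => ln_col_sum M i); last first.
    by apply/funext => M /=; rewrite tnth_mktuple.
  rewrite /ln_col_sum; under eq_fun do rewrite -big_filter.
  apply: measurable_sum => j; apply: measurableT_comp => //.
  by apply: measurable_funB => //; exact: measurable_entry.
Qed.

(** The joint density of the off-diagonal entries with respect to the uniform
reference, written as a function of the statistic alone. *)
Definition matrix_lik (a b : 'I_n -> R) (y : n.-tuple R * n.-tuple R) : R :=
  \prod_(ij : 'I_n * 'I_n | ij.1 != ij.2) beta_const (a ij.1) (b ij.2) *
  expR (\sum_i (a i - 1) * tnth y.1 i + \sum_j (b j - 1) * tnth y.2 j).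

Lemma matrix_lik_ge0 a b y : 0 <= matrix_lik a b y.
Proof.
by rewrite mulr_ge0 ?expR_ge0// prodr_ge0// => ij _; exact: beta_const_ge0.
Qed.

Lemma measurable_matrix_lik a b : measurable_fun setT (matrix_lik a b).
Proof.
apply: measurable_funM => //; apply: measurableT_comp => //.
apply: measurable_funD; apply: measurable_sum => i;
  apply: measurable_funM => //.
- exact: (measurableT_comp (measurable_tnth i) measurable_fst).
- exact: (measurableT_comp (measurable_tnth i) measurable_snd).
Qed.

(** This is the factorization: [\sum_(i != j) (a_i - 1) ln w_ij] groups by rows
into the [R_i], and [\sum_(i != j) (b_j - 1) ln (1 - w_ij)] groups by columns
into the [C_j]. *)
Lemma matrix_likE a b (M : 'M[R]_n) :
  matrix_lik a b (row_col_stat (M : mxspace R n)) =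
  \prod_(ij in [set ij : 'I_n * 'I_n | ij.1 != ij.2]%SET)
    beta_lik (a ij.1) (b ij.2) (M ij.1 ij.2).
Proof.
rewrite (eq_bigl (fun ij => ij.1 != ij.2)); last by move=> ij; rewrite inE.
rewrite /beta_lik big_split/= /matrix_lik; congr (_ * _).
rewrite -expR_sum; congr expR.
rewrite [RHS]big_split; congr (_ + _).
- rewrite -(pair_big_dep xpredT (fun i j => i != j)
    (fun i j => (a i - 1) * ln (M i j)))/=.
  apply: eq_bigr => i _; rewrite tnth_mktuple /ln_row_sum mulr_sumr.
  by apply: eq_bigl => j; rewrite eq_sym.
- rewrite -(pair_big_dep xpredT (fun i j => i != j)
    (fun i j => (b j - 1) * ln (1 - M i j)))/=.
  rewrite (exchange_big_dep xpredT)//=.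
  apply: eq_bigr => j _; rewrite tnth_mktuple /ln_col_sum mulr_sumr.
  by apply: eq_bigl => i.
Qed.

(** Both sides are measures, so that it is enough to compare them on rectangles.
There, independence splits each side into a product over [i != j], and
beta_law_lik compares the factors. *)
Lemma beta_matrix_law_lik d0 (T0 : measurableType d0) (P0 : probability T0 R)
    (W0 : {RV P0 >-> mxspace R n}) d (T : measurableType d)
    (P : probability T R) (W : {RV P >-> mxspace R n}) (a b : 'I_n -> R) :
  beta_random_matrix P0 W0 (fun=> 1) (fun=> 1) ->
  beta_random_matrix P W a b ->
  forall B, measurable B ->
    (distribution P W B =
     \int[distribution P0 W0]_(M in B) (matrix_lik a b (row_col_stat M))%:E)%E.
Proof.
move=> [W0d W0i W0b] [Wd Wi Wb].
have mH :
    measurable_fun [set: mxspace R n] (matrix_lik a b \o @row_col_stat R n).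
  apply: measurableT_comp; first exact: measurable_matrix_lik.
  exact: measurable_row_col_stat.
have H0 M : 0 <= (matrix_lik a b \o @row_col_stat R n) M.
  exact: matrix_lik_ge0.
pose nu : {measure set (mxspace R n) -> \bar R} :=
  weighted_measure (distribution P0 W0) mH H0.
have Woo : (distribution P W setT < +oo)%E.
  by rewrite [distribution P W setT]probability_setT ltry.
move=> B mB; apply: (@mx_rect_measure_unique (distribution P W) nu _ Woo B mB).
move=> {B mB} A mA.
change (P (W @^-1` mx_rect A) = \int[distribution P0 W0]_(M in mx_rect A)
  (matrix_lik a b (row_col_stat M))%:E)%E.
have mrect : measurable (mx_rect A) by apply: measurable_mx_rect; exists A.
have mW d1 (S : measurableType d1) (V : {mfun S >-> mxspace R n}) i j :
    measurable_fun [set: S] (fun t => (V t : 'M[R]_n) i j).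
  by apply: (measurableT_comp (measurable_entry i j)); exact: measurable_funP.
rewrite ge0_integral_pushforward//; last 2 first.
- by apply/measurable_EFinP; exact: measurable_funTS.
- by move=> M _; rewrite lee_fin matrix_lik_ge0.
pose D := [set ij : 'I_n * 'I_n | ij.1 != ij.2]%SET.
(* The diagonal entries are 0, so that a rectangle whose diagonal sides do not
   all contain 0 is never met, and the diagonal is no constraint otherwise. *)
have [A0|A0] := pselect (forall i, A i i 0); last first.
  have pre0 d1 (S : measurableType d1) (V : S -> mxspace R n) :
      (forall t i, (V t : 'M[R]_n) i i = 0) -> V @^-1` mx_rect A = set0.
    move=> Vd; apply/seteqP; split => // t AV; apply: A0 => i.
    by rewrite -(Vd t i); exact: AV.
  by rewrite !pre0// measure0 integral_set0.
have preE d1 (S : measurableType d1) (V : S -> mxspace R n) :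
    (forall t i, (V t : 'M[R]_n) i i = 0) -> V @^-1` mx_rect A =
    \bigcap_(ij in [set` D])
      ((fun t => (V t : 'M[R]_n) ij.1 ij.2) @^-1` A ij.1 ij.2).
  move=> Vd; apply/seteqP; split => [t AV [i j] _|t AV i j]; first exact: AV.
  have [->|ij] := eqVneq i j; first by rewrite Vd.
  by apply: (AV (i, j)); rewrite /= inE.
pose f (ij : 'I_n * 'I_n) w : R :=
  \1_(A ij.1 ij.2) w * beta_lik (a ij.1) (b ij.2) w.
pose m (ij : 'I_n * 'I_n) : R :=
  fine (P ((fun t => (W t : 'M[R]_n) ij.1 ij.2) @^-1` A ij.1 ij.2)).
have mE ij : (m ij)%:E =
    P ((fun t => (W t : 'M[R]_n) ij.1 ij.2) @^-1` A ij.1 ij.2).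
  rewrite fineK// fin_num_measure//.
  exact: (measurable_preimage (mW _ _ W ij.1 ij.2) (mA _ _)).
rewrite (preE _ _ W)// Wi//.
transitivity (\prod_(ij in D) m ij)%:E.
  by rewrite -prodEFin; apply: eq_bigr => ij _; rewrite mE.
rewrite -(expectation_prod_indep (f := f) _ W0i).
- rewrite [RHS]integral_mkcond; apply: eq_integral => t _.
  rewrite /patch; case: ifPn => [|tA].
    rewrite inE => tA /=; rewrite matrix_likE; congr EFin.
    apply: eq_bigr => ij _.
    by rewrite /f indicE mem_set ?mul1r//; exact: tA.
  have : ~ (\bigcap_(ij in [set` D])
      ((fun t => (W0 t : 'M[R]_n) ij.1 ij.2) @^-1` A ij.1 ij.2)) t.
    by rewrite -preE//; move: tA; rewrite notin_setE.
  move=> nA.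
  have [ij ijD nAij] : exists2 ij, ij \in D &
      ~ A ij.1 ij.2 ((W0 t : 'M[R]_n) ij.1 ij.2).
    apply: contrapT => nex; apply: nA => ij /= ijD.
    by apply: contrapT => nAij; apply: nex; exists ij.
  by rewrite (bigD1 ij)//= /f indicE memNset// !mul0r.
- by move=> ij _; exact: mW.
- move=> ij; apply: measurable_funM; first exact: measurable_indic.
  exact: measurable_beta_lik.
- by move=> ij w; rewrite mulr_ge0 ?beta_lik_ge0.
- move=> [i j]; rewrite inE /= => ij; rewrite mE /=.
  rewrite (beta_law_lik (mW _ _ _ i j) (W0b _ _ ij) (Wb _ _ ij))//.
  rewrite [RHS]integral_mkcond; apply: eq_integral => t _.
  by rewrite epatch_indic /f /= EFinM muleC.
Qed.

End matrix_space.

Theorem mainTheorem4 (R : realType) (n : nat) (d : measure_display)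
    (Omega : beta_param R n -> measurableType d)
    (P : forall theta : beta_param R n, probability (Omega theta) R)
    (W : forall theta : beta_param R n, {RV (P theta) >-> mxspace R n}) :
  (2 <= n)%N ->
  (forall theta : beta_param R n,
     beta_random_matrix (P theta) (W theta) (param_a theta) (param_b theta)) ->
  sufficient (fun theta : beta_param R n => distribution (P theta) (W theta))
    (@row_col_stat R n).
Proof.
move=> _ Wbeta.
(* at this parameter the entries are uniform on (0,1) *)
pose theta0 : beta_param R n :=
  @BetaParam R n (fun=> 1) (fun=> 1) (fun=> ltr01) (fun=> ltr01).
apply: (@factorization_sufficient _ _ _ _ _ _ _ _ theta0
  (fun theta => matrix_lik (param_a theta) (param_b theta))).
- exact: measurable_row_col_stat.
- by move=> theta; exact: measurable_matrix_lik.
- by move=> theta y; exact: matrix_lik_ge0.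
- by move=> theta A mA; apply: (beta_matrix_law_lik (Wbeta theta0)).
Qed.
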